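(* Let $(X,\mathcal{N})$ be a reduced $\sigma$-algebra, and let $(Y,\delta)$ be a proximity space. Then a map $f:(X,\delta_{\mathcal{N}})\rightarrow(Y,\delta)$ is a proximity map if and only if $f$ is a proximity map from $(X,\delta_{\mathcal{N}})$ to $(Y,\delta)_{\aleph_{1}}$.
   Context: A proximity space is a pair $(X,\delta)$ where $X$ is a set and $\delta$ is a relation on the power set $P(X)$ (with negation $\overline{\delta}$) such that: (1) $A\delta B$ implies $B\delta A$; (2) $(A\cup B)\delta C$ iff $A\delta C$ or $B\delta C$; (3) $A\delta B$ implies $A\neq\emptyset$ and $B\neq\emptyset$; (4) if $A\overline{\delta}B$, then there is a set $E\subseteq X$ with $A\overline{\delta}E$ and $E^{c}\overline{\delta}B$; (5) if $A\cap B\neq\emptyset$, then $A\delta B$. All proximity spaces are assumed separated: $\{x\}\delta\{y\}$ implies $x=y$. Here $A^c$ denotes the complement. A function $f:(X,\delta)\to(Y,\rho)$ between proximity spaces is a proximity map if $f(A)\rho f(B)$ whenever $A\delta B$. The interval $[0,1]$ carries its unique proximity compatible with its usual topology: $A$ is near $B$ iff $\overline{A}\cap\overline{B}\neq\emptyset$. An algebra of sets (in particular a $\sigma$-algebra) $(X,\mathcal{M})$ is reduced if whenever $x,y\in X$ are distinct there is $R\in\mathcal{M}$ with $x\in R$, $y\in R^{c}$. For an algebra of sets $(X,\mathcal{M})$, $\delta_{\mathcal{M}}$ is the proximity on $X$ given by: $U\overline{\delta_{\mathcal{M}}}V$ iff there is some $R\in\mathcal{M}$ with $U\subseteq R$ and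 $V\subseteq R^{c}$. A proximally zero set of a proximity space $(Y,\delta)$ is a set of the form $g^{-1}(0)$ for some proximity map $g:(Y,\delta)\to[0,1]$. The $\sigma$-algebra $\mathcal{B}^{*}(Y,\delta)$ of proximally Baire sets is the smallest $\sigma$-algebra on $Y$ containing all proximally zero sets. Define $(Y,\delta)_{\aleph_{1}}=(Y,\delta_{\mathcal{B}^{*}(Y,\delta)})$. *)

(* Defs.v *)
From mathcomp Require Import all_boot all_order all_algebra.
From mathcomp Require Import all_classical all_reals all_analysis.
Import Order.TTheory GRing.Theory Num.Theory.
Import numFieldNormedType.Exports.

Set Implicit Arguments.
Unset Strict Implicit.
Unset Printing Implicit Defensive.

Local Open Scope classical_set_scope.
Local Open Scope ring_scope.

Record separated_proximity (X : Type) (delta : set X -> set X -> Prop) : Prop :=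
  SeparatedProximity {
    prox_sym : forall A B, delta A B -> delta B A;
    prox_setU : forall A B C,
      delta (A `|` B) C <-> delta A C \/ delta B C;
    prox_neq0 : forall A B, delta A B -> A !=set0 /\ B !=set0;
    prox_interpolate : forall A B, ~ delta A B ->
      exists E : set X, ~ delta A E /\ ~ delta (~` E) B;
    prox_meet : forall A B, A `&` B !=set0 -> delta A B;
    prox_separated : forall x y : X, delta [set x] [set y] -> x = y }.

Definition proximity_map (X Y : Type) (delta : set X -> set X -> Prop)
    (rho : set Y -> set Y -> Prop) (f : X -> Y) : Prop :=
  forall A B : set X, delta A B -> rho (f @` A) (f @` B).

(* The subtype carries the subspace topology, so [closure] below is the closure
   in [0, 1]. *)
Notation unit_interval R := (set_type (`[0, 1]%classic : set R)).

Definition unit_interval_prox (R : realType)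
    (A B : set (unit_interval R)) : Prop :=
  closure A `&` closure B !=set0.

Definition reduced (X : Type) (M : set (set X)) : Prop :=
  forall x y : X, x <> y -> exists2 S, M S & S x /\ (~` S) y.

Definition algebra_prox (X : Type) (M : set (set X)) (U V : set X) : Prop :=
  ~ exists2 S, M S & U `<=` S /\ V `<=` ~` S.

Definition proximally_zero (R : realType) (Y : Type)
    (delta : set Y -> set Y -> Prop) (Z : set Y) : Prop :=
  exists2 g : Y -> unit_interval R,
    proximity_map delta (@unit_interval_prox R) g &
    Z = [set y | set_val (g y) = 0].

Definition proximally_Baire (R : realType) (Y : Type)
    (delta : set Y -> set Y -> Prop) : set (set Y) :=
  <<s [set Z | proximally_zero R delta Z] >>.

Definition aleph1_prox (R : realType) (Y : Type)
    (delta : set Y -> set Y -> Prop) : set Y -> set Y -> Prop :=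
  algebra_prox (proximally_Baire R delta).

(* Main.v *)
Require Import Defs.
From mathcomp Require Import all_boot all_order all_algebra.
From mathcomp Require Import all_classical all_reals all_analysis.
From mathcomp Require Import lra.
Import Order.TTheory GRing.Theory Num.Theory.
Import numFieldNormedType.Exports.

Set Implicit Arguments.
Unset Strict Implicit.
Unset Printing Implicit Defensive.

Local Open Scope ring_scope.
Local Open Scope classical_set_scope.

(** Write [d_N] for [algebra_prox N].  The two directions rest on two facts
    about the sigma-algebra of proximally Baire sets.

    - It is fine enough to recover [delta]: sets that are far in [delta] are
      separated by a proximally zero set ([proximally_Baire_separation]).  So
      a map which is a proximity map into [aleph1_prox R delta] is one into
      [delta].  This is Urysohn's lemma for
      proximities.  Interpolating repeatedly between A and the complement of B
      gives sets indexed by the dyadic numbers, each well inside the next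
      ([dyadic_chain]), and the infimum of the indices of the sets containing
      y is the value at y of a function that vanishes on A and nowhere on B.
      Two levels [v <= a] and [b <= v] with a < b are far since two
      consecutive sets of the chain fit between them, and that alone makes the
      function a proximity map into the unit interval
      ([levels_far_proximity_map]).

    - It is coarse enough to pull back: a proximity map f from [d_N] pulls
      proximally Baire sets back into N ([proximally_Baire_preimage]). It is
      enough to treat a zero set of g, since the sets whose preimage lies in N
      form a sigma-algebra. The composite v of f and g is a proximity map, and
      the images of [v = 0] and [1 / n <= v] have disjoint closures in the
      unit interval, so some member of N separates these two sets; the
      intersection of these members over n is exactly [v = 0]. If now the
      images of A and B are separated by a proximally Baire set, its preimage
      separates A and B in N; so f preserves nearness to [aleph1_prox R
      delta]. *)

(** * Urysohn functions of a proximity *)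

Section Proximity.
Context (Y : Type) (delta : set Y -> set Y -> Prop).
Context (prox_delta : separated_proximity delta).

Lemma prox_sub (A A' B B' : set Y) :
  A `<=` A' -> B `<=` B' -> delta A B -> delta A' B'.
Proof.
have sub_l C D E : C `<=` D -> delta C E -> delta D E.
  by move=> /setUidPr <- CE; apply/(prox_setU prox_delta); left.
move=> AA' BB' /(sub_l _ _ _ AA') /(prox_sym prox_delta).
by move=> /(sub_l _ _ _ BB') /(prox_sym prox_delta).
Qed.

(** The strong inclusion, or proximal neighbourhood relation, of proximity
    theory. *)
Definition well_inside (A B : set Y) := ~ delta A (~` B).

Lemma well_inside_sub A B : well_inside A B -> A `<=` B.
Proof.
move=> AB x Ax; apply: contrapT => Bx; apply: AB.
by apply: (prox_meet prox_delta); exists x.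
Qed.

Lemma well_inside_setT A : well_inside A setT.
Proof. by move=> /(prox_neq0 prox_delta)[_ []]; rewrite setCT. Qed.

Lemma well_inside_interpolate A B :
  well_inside A B -> exists C, well_inside A C /\ well_inside C B.
Proof.
move=> /(prox_interpolate prox_delta)[E [AE EB]]; exists (~` E).
by rewrite /well_inside setCK.
Qed.

(** The implication is put under the existential so that the choice below is
    a total function on pairs of sets, which the recursion defining
    [dyadic_chain] can call before anything is known about its arguments. *)
Lemma interpolant_exists (A B : set Y) :
  exists C, well_inside A B -> well_inside A C /\ well_inside C B.
Proof.
have [/well_inside_interpolate[C AC]|] := pselect (well_inside A B).
  by exists C.
by exists set0.
Qed.

Definition interpolant (A B : set Y) : set Y :=
  projT1 (cid (interpolant_exists A B)).

Lemma interpolantP A B :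
  well_inside A B ->
  well_inside A (interpolant A B) /\ well_inside (interpolant A B) B.
Proof. by rewrite /interpolant; case: cid. Qed.

(** The k-th set of rank n stands at the dyadic number k / 2^n.  Rank 0 is
    A, B, then the whole space for ever: every set is well inside the whole
    space, so consecutive sets are well inside each other for all k, and every
    point belongs to some set of the chain. *)
Fixpoint dyadic_chain (A B : set Y) (n k : nat) : set Y :=
  match n with
  | 0 => if k is k'.+1 then (if k' is 0 then B else setT) else A
  | m.+1 => let U := dyadic_chain A B m in
            if odd k then interpolant (U k./2) (U k./2.+1) else U k./2
  end.

Section DyadicChain.
Context (A B : set Y).
Context (AB : well_inside A B).

Local Notation U := (dyadic_chain A B).

Lemma dyadic_chainS n k : well_inside (U n k) (U n k.+1).
Proof.
elim: n k => [[|[|k]]|n IH k] //=; try exact: well_inside_setT.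
rewrite uphalf_half; have [H1 H2] := interpolantP (IH k./2).
by case: (odd k).
Qed.

Lemma dyadic_chain_homo n k l : (k <= l)%N -> U n k `<=` U n l.
Proof.
move=> /subnKC <-; elim: (l - k)%N => [|d IH]; first by rewrite addn0.
rewrite addnS; apply: (subset_trans IH).
by apply: well_inside_sub; exact: dyadic_chainS.
Qed.

Lemma dyadic_chain_refine n m k : U (n + m) (k * 2 ^ m) = U n k.
Proof.
elim: m => [|m IH]; first by rewrite addn0 muln1.
by rewrite addnS expnSr mulnA muln2 /= odd_double doubleK.
Qed.

Context (R : realType).

(** By [dyadic_chain_refine] a set depends only on its dyadic number, so two
    sets of different ranks can be compared within a common finer rank. *)
Lemma dyadic_chain_le m n l k :
  l%:R / 2 ^+ m <= k%:R / 2 ^+ n :> R -> U m l `<=` U n k.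
Proof.
rewrite ler_pdivrMr ?exprn_gt0// mulrAC ler_pdivlMr ?exprn_gt0//.
rewrite -!natrX -!natrM ler_nat => lk.
rewrite -(dyadic_chain_refine m n l) -(dyadic_chain_refine n m k) addnC.
exact: dyadic_chain_homo.
Qed.

Lemma exists_consecutive_dyadics (a b : R) : 0 <= a -> a < b ->
  exists n k, a < k%:R / 2 ^+ n /\ k.+1%:R / 2 ^+ n < b.
Proof.
move=> a0 ab; set n := Num.bound (2 / (b - a)).
have nlt : 2 / (b - a) < 2 ^+ n.
  apply: (@lt_trans _ _ n%:R).
    by apply: archi_boundP; rewrite divr_ge0// subr_ge0 ltW.
  by rewrite -natrX ltr_nat ltn_expl.
have p0 : 0 < 2 ^+ n :> R by rewrite exprn_gt0.
exists n, (Num.truncn (a * 2 ^+ n)).+1.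
have /truncn_itv/andP[lo hi] : 0 <= a * 2 ^+ n by rewrite mulr_ge0// ltW.
rewrite ltr_pdivlMr// hi; split=> //.
rewrite ltr_pdivrMr// -[X in X%:R < _]addn2 natrD.
move: nlt; rewrite ltr_pdivrMr ?subr_gt0// mulrBr ![2 ^+ n * _]mulrC => nlt.
by lra.
Qed.

(** The dyadic numbers are halved here, because the sets of the chain become
    the whole space only from the index 2 on: halving brings the infimum into
    the unit interval. *)
Definition dyadic_levels (y : Y) : set R :=
  [set r | exists n k, U n k y /\ r = k%:R / 2 ^+ n.+1].

Definition urysohn_fun (y : Y) : R := inf (dyadic_levels y).

Lemma has_inf_dyadic_levels y : has_inf (dyadic_levels y).
Proof.
split; first by exists 1, 0%N, 2%N; split=> //; rewrite divff.
by exists 0 => _ [n [k [_ ->]]]; rewrite divr_ge0.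
Qed.

Lemma urysohn_fun_le n k y : U n k y -> urysohn_fun y <= k%:R / 2 ^+ n.+1.
Proof.
by move=> Uy; apply: ge_inf; [case: (has_inf_dyadic_levels y)|exists n, k].
Qed.

Lemma urysohn_fun_lt n k y : urysohn_fun y < k%:R / 2 ^+ n.+1 -> U n k y.
Proof.
move=> /(inf_lt (has_inf_dyadic_levels y).1)[_ [m [l [Uy ->]]]] /ltW.
rewrite !exprS !invfM !(mulrCA _ 2^-1) ler_pM2l// => lk.
exact: (dyadic_chain_le lk).
Qed.

Lemma urysohn_fun_itv y : 0 <= urysohn_fun y <= 1.
Proof.
apply/andP; split.
  apply: lb_le_inf; first by case: (has_inf_dyadic_levels y).
  by move=> _ [n [k [_ ->]]]; rewrite divr_ge0.
have /urysohn_fun_le : U 0 2 y by [].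
by rewrite expr1 divff.
Qed.

Lemma urysohn_fun_eq0 y : A y -> urysohn_fun y = 0.
Proof.
move=> Ay; apply/eqP; rewrite eq_le; have /andP[-> _] := urysohn_fun_itv y.
by have /urysohn_fun_le : U 0 0 y by []; rewrite mul0r => ->.
Qed.

Lemma urysohn_fun_neq0 y : ~ B y -> urysohn_fun y <> 0.
Proof.
move=> By g0; apply: By; apply: (@urysohn_fun_lt 0 1); rewrite g0.
by rewrite divr_gt0.
Qed.

(** A pair of consecutive dyadic numbers whose halves lie strictly between a
    and b gives sets C, D of the chain with C well inside D,
    [urysohn_fun <= a] contained in C and [b <= urysohn_fun] disjoint from
    D. *)
Lemma urysohn_fun_far (a b : R) : a < b ->
  ~ delta [set y | urysohn_fun y <= a] [set y | b <= urysohn_fun y].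
Proof.
move=> ab; have [a0|a0] := leP 0 a; last first.
  move=> /(prox_neq0 prox_delta)[[y /= ya] _].
  have /andP[y0 _] := urysohn_fun_itv y; lra.
(* The doubling undoes the halving of the dyadic levels. *)
have [||n [k [ak kb]]] := @exists_consecutive_dyadics (2 * a) (2 * b);
  [lra|lra|].
have half j : j%:R / 2 ^+ n.+1 = 2^-1 * (j%:R / 2 ^+ n) :> R.
  by rewrite exprS invfM mulrCA.
move=> near; apply: (@dyadic_chainS n k); apply: prox_sub near => y /= gy.
  apply: urysohn_fun_lt; rewrite half; lra.
move=> /urysohn_fun_le; rewrite half; lra.
Qed.

End DyadicChain.

End Proximity.

(** * Proximity maps into the unit interval *)

Section UnitInterval.
Context (R : realType).

Lemma unit_interval_itv (t : unit_interval R) : 0 <= set_val t <= 1.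
Proof. by have := set_valP t; rewrite /= in_itv. Qed.

Definition unit_interval_of (x : R) (x01 : 0 <= x <= 1) : unit_interval R :=
  SigSub (mem_set (x01 : `[0, 1]%classic x)).

Lemma closure_unit_interval (A : set (unit_interval R)) (t : unit_interval R) :
  (forall e : R, 0 < e -> exists2 a, A a & `|set_val t - set_val a| < e) ->
  closure A t.
Proof.
move=> At B [_ [[W oW <-] /= Wt sWB]].
have /nbhs_ballP[e /= e0 eW] : nbhs (set_val t) W by exact: open_nbhs_nbhs.
by have [a Aa ta] := At e e0; exists a; split => //; apply: sWB; exact: eW.
Qed.

Lemma unit_interval_levels_far (A B : set (unit_interval R)) (a b : R) :
  a < b -> (forall t, A t -> set_val t <= a) ->
  (forall t, B t -> b <= set_val t) -> ~ unit_interval_prox A B.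
Proof.
move=> ab Aa Bb [t [At Bt]].
have vc : continuous (set_val : unit_interval R -> R).
  exact: initial_continuous.
have ta : set_val t <= a.
  have := At; rewrite closureE => /(_ [set s | set_val s <= a]); apply.
  split; last exact: Aa.
  apply: (@closed_comp _ _ set_val [set x : R | x <= a]); last exact: closed_le.
  by move=> s _; exact: vc.
have tb : b <= set_val t.
  have := Bt; rewrite closureE => /(_ [set s | b <= set_val s]); apply.
  split; last exact: Bb.
  apply: (@closed_comp _ _ set_val [set x : R | b <= x]); last exact: closed_ge.
  by move=> s _; exact: vc.
by move: (lt_le_trans ab tb); rewrite ltNge ta.
Qed.

(** If P is near Q, a common closure point of the images comes from a
    supremum, which replaces compactness: let t be the supremum of the s for
    which the part of P where g <= s is far from Q.
    Then for every e > 0 the part of P where g is e-close to t is near Q; as it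
    is far from the points where g is not within a slightly larger distance
    of t, it is near the part of Q close to t, and both parts are nonempty. *)
Lemma levels_far_proximity_map (Y : Type) (delta : set Y -> set Y -> Prop)
    (g : Y -> unit_interval R) :
  separated_proximity delta ->
  (forall a b : R, a < b ->
    ~ delta [set y | set_val (g y) <= a] [set y | b <= set_val (g y)]) ->
  proximity_map delta (@unit_interval_prox R) g.
Proof.
move=> prox_delta far_levels P Q PQ.
pose v y : R := set_val (g y).
have v01 y : 0 <= v y <= 1 by exact: unit_interval_itv.
pose S : set R := [set s | ~ delta (P `&` [set y | v y <= s]) Q].
have S_lt0 s : s < 0 -> S s.
  move=> s0 /(prox_neq0 prox_delta)[[y [_ /= ys]] _].
  by have := v01 y; lra.
have S_ge1 s : S s -> s < 1.
  move=> Ss; rewrite ltNge; apply/negP => s1; apply: Ss.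
  apply: (prox_sub prox_delta) PQ => // y Py; split => //=.
  by have := v01 y; lra.
have supS : has_sup S.
  split; first by exists (-1); apply: S_lt0; lra.
  by exists 1 => s /S_ge1/ltW.
pose t := sup S.
have t01 : 0 <= t <= 1.
  apply/andP; split.
    apply/ler_addgt0Pr => e e0.
    have /S_lt0/(sup_upper_bound supS) : - e < 0 by lra.
    by rewrite -/t; lra.
  by apply: (ge_sup supS.1) => s /S_ge1/ltW.
have near_t e : 0 < e ->
    (exists2 y, P y & `|t - v y| < e) /\ (exists2 y, Q y & `|t - v y| < e).
  move=> e0.
  (* The window (t - e / 4, t + e / 4] leaves room on both sides for the
     levels t - e and t + e to be far from it. *)
  have e4 : 0 < e / 4 by lra.
  have [s Ss ts] := sup_adherent e4 supS; rewrite -/t in ts.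
  have : ~ S (t + e / 4).
    by move=> /(sup_upper_bound supS); rewrite -/t; lra.
  move=> /contrapT near_below.
  (* W is the part of P close to t; it inherits the nearness to Q. *)
  pose W := P `&` [set y | s < v y <= t + e / 4].
  have : delta ((P `&` [set y | v y <= s]) `|` W) Q.
    apply: (prox_sub prox_delta) near_below => // y [Py /= yt].
    by have [ys|ys] := leP (v y) s; [left|right; split => //=; apply/andP].
  move=> /(prox_setU prox_delta)[/Ss//|near_W]; split.
    have [[y [Py /= /andP[sy yt]]] _] := prox_neq0 prox_delta near_W.
    by exists y => //; rewrite ltr_norml; apply/andP; split; lra.
  apply: contrapT => noQ.
  have : delta ([set y | v y <= t - e] `|` [set y | t + e <= v y]) W.
    apply: (prox_sub prox_delta) (prox_sym prox_delta near_W) => // y Qy /=.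
    have [|ty] := leP (v y) (t - e); first by left.
    have [|yt] := leP (t + e) (v y); first by right.
    exfalso; apply: noQ; exists y => //.
    by rewrite ltr_norml; apply/andP; split; lra.
  have lo : t - e < s by lra.
  have hi : t + e / 4 < t + e by lra.
  move=> /(prox_setU prox_delta)[near_lo|near_hi].
    apply: (far_levels _ _ lo).
    apply: (prox_sub prox_delta) near_lo => // y [_ /andP[/ltW]] //.
  apply: (far_levels _ _ hi).
  apply: (prox_sub prox_delta) (prox_sym prox_delta near_hi) => // y.
  by move=> [_ /andP[]].
exists (unit_interval_of t01); split; apply: closure_unit_interval => e.
- by move=> /near_t[[y Py ye] _]; exists (g y) => //; exists y.
- by move=> /near_t[_ [y Qy ye]]; exists (g y) => //; exists y.
Qed.

End UnitInterval.

(** * Proximally Baire sets *)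

Section ProximallyBaire.
Context (R : realType).

Lemma proximally_Baire_separation (Y : Type) (delta : set Y -> set Y -> Prop)
    (A B : set Y) :
  separated_proximity delta -> ~ delta A B ->
  exists2 S, proximally_Baire R delta S & A `<=` S /\ B `<=` ~` S.
Proof.
move=> prox_delta AB.
have A_in_B : well_inside delta A (~` B) by rewrite /well_inside setCK.
pose v := urysohn_fun prox_delta A (~` B) R.
pose g y := unit_interval_of (urysohn_fun_itv prox_delta A (~` B) R y).
exists [set y | v y = 0]; last first.
  split=> y; first exact: urysohn_fun_eq0.
  by move=> By; apply: (urysohn_fun_neq0 A_in_B) => /=; exact.
apply: sub_sigma_algebra; exists g => //.
apply: levels_far_proximity_map => // a b.
exact: (urysohn_fun_far A_in_B).
Qed.

Lemma proximally_zero_preimage (X Y : Type) (N : set (set X))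
    (delta : set Y -> set Y -> Prop) (f : X -> Y) (Z : set Y) :
  sigma_algebra setT N -> proximity_map (algebra_prox N) delta f ->
  proximally_zero R delta Z -> N (f @^-1` Z).
Proof.
move=> [N0 NC NU] f_prox [g g_prox ->].
pose v x : R := set_val (g (f x)).
(* S n separates [v = 0] from [1 / (n + 1) <= v]. *)
have /choice[S SP] (n : nat) : exists S, N S /\
    [set x | v x = 0] `<=` S /\ [set x | n.+1%:R^-1 <= v x] `<=` ~` S.
  have : ~ algebra_prox N [set x | v x = 0] [set x | n.+1%:R^-1 <= v x].
    move=> /f_prox/g_prox.
    apply: (@unit_interval_levels_far R _ _ 0 n.+1%:R^-1).
    - by rewrite invr_gt0.
    - by move=> _ [_ [x /= vx <-] <-]; rewrite -/(v x) vx.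
    - by move=> _ [_ [x /= vx <-] <-].
  by move=> /contrapT[S NS SP]; exists S.
(* The intersection of the S n, written with the operations under which a
   sigma-algebra is closed by definition. *)
suff -> : f @^-1` [set y | set_val (g y) = 0] =
    setT `\` \bigcup_n (setT `\` S n).
  by apply/NC/NU => n; apply/NC; case: (SP n).
apply/seteqP; split=> [x /= vx|x /= [_ xS]].
  split=> // -[n _ [_]]; apply.
  by have [_ [+ _]] := SP n; apply.
have /andP[v0 _] := unit_interval_itv (g (f x)).
apply/eqP; rewrite eq_le v0 andbT leNgt; apply/negP => vx.
have : (Num.truncn (v x)^-1).+1%:R^-1 <= v x.
  rewrite invf_ple ?posrE//.
  exact/ltW/truncnS_gt.
set n := Num.truncn _ => nv; apply: xS; exists n => //; split => //.
by have [_ [_ +]] := SP n; apply.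
Qed.

Lemma proximally_Baire_preimage (X Y : Type) (N : set (set X))
    (delta : set Y -> set Y -> Prop) (f : X -> Y) (S : set Y) :
  sigma_algebra setT N -> proximity_map (algebra_prox N) delta f ->
  proximally_Baire R delta S -> N (f @^-1` S).
Proof.
move=> sigmaN f_prox BS.
suff : image_set_system setT f N S by rewrite /image_set_system /= setTI.
apply: BS; split; first exact: sigma_algebra_image.
move=> Z ZZ; rewrite /image_set_system /= setTI.
exact: proximally_zero_preimage ZZ.
Qed.

End ProximallyBaire.

Theorem theorem2p12 (R : realType) (X Y : Type) (N : set (set X))
    (sigmaN : sigma_algebra setT N) (reducedN : reduced N)
    (delta : set Y -> set Y -> Prop) (prox_delta : separated_proximity delta)
    (f : X -> Y) :
  proximity_map (algebra_prox N) delta f <->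
  proximity_map (algebra_prox N) (aleph1_prox R delta) f.
Proof.
split=> f_prox A B AB.
  move=> [S BS [fAS fBS]]; apply: AB; exists (f @^-1` S).
    exact: proximally_Baire_preimage BS.
  by split=> x ?; [apply: fAS; exists x|apply: fBS; exists x].
apply: contrapT => /(proximally_Baire_separation R prox_delta).
exact: f_prox AB.
Qed.
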